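(* Let $\lambda,\mu>0$, let $T:\mathcal H\to\mathcal H$ be a $\lambda$-relaxed cutter and $U:\mathcal H\to\mathcal H$ be a $\mu$-relaxed cutter with $\operatorname{Fix}T\cap\operatorname{Fix}U\neq\emptyset$. Suppose that $T$ and $U$ satisfy the demi closedness principle and that $\lambda\mu<4$. Let $\nu^*:=\frac{4(\lambda+\mu-\lambda\mu)}{4-\lambda\mu}$ and let $\tau:\mathcal H\to(0,+\infty)$ be a function such that, for all $x\notin\operatorname{Fix}T\cap\operatorname{Fix}U$, $$\frac{\|a_1+b_1\|^2}{\frac1\lambda\|a_1\|^2+\frac1\mu\|b_1\|^2+\langle a_1,b_1\rangle}\le\tau(x)\le\nu^*,$$ where $a_1:=T(x)-x$ and $b_1:=UT(x)-T(x)$. Let $x^0\in\mathcal H$ be arbitrary, let $\lambda_k\in[\varepsilon,2-\varepsilon]$, $k\ge0$, for some $\varepsilon\in(0,1)$, and let $$x^{k+1}=x^k+\frac{\lambda_k}{\tau(x^k)}\big(UT(x^k)-x^k\big),\qquad k\ge0.$$ Then $\{x^k\}_{k=0}^\infty$ converges weakly to an element of $\operatorname{Fix}T\cap\operatorname{Fix}U$.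
   Context: $\mathcal H$ is a real Hilbert space with $\mathcal H\neq\{0\}$; $UT$ denotes the composition $U\circ T$; $\operatorname{Fix}S:=\{z\in\mathcal H:S(z)=z\}$. For $\lambda>0$, $T:\mathcal H\to\mathcal H$ with $\operatorname{Fix}T\neq\emptyset$ is a $\lambda$-relaxed cutter if $\lambda\langle z-x,T(x)-x\rangle\ge\|T(x)-x\|^2$ for all $x\in\mathcal H$, $z\in\operatorname{Fix}T$. An operator $T$ satisfies the demi closedness principle if for any bounded sequence $\{x^k\}$ with $\|T(x^k)-x^k\|\to0$, every weak cluster point of $\{x^k\}$ belongs to $\operatorname{Fix}T$. *)

(* Defs.v *)
From HB Require Import structures.
From mathcomp Require Import all_boot all_order all_algebra.
From mathcomp Require Import sesquilinear.
From mathcomp Require Import all_classical all_reals all_analysis.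

Set Implicit Arguments.
Unset Strict Implicit.
Unset Printing Implicit Defensive.

Import Order.TTheory GRing.Theory Num.Theory.
Import numFieldNormedType.Exports.

Local Open Scope classical_set_scope.
Local Open Scope ring_scope.

(* Throughout, a real Hilbert space is a complete normed module [H] together
   with a symmetric positive definite form [dot] inducing its norm; the latter
   condition is [hilbert_norm dot]. *)
Definition hilbert_norm (R : realType) (H : completeNormedModType R)
    (dot : {dot H for idfun}) : Prop :=
  forall x : H, `|x| ^+ 2 = dot x x.

Definition Fix (T : Type) (S : T -> T) : set T := [set z | S z = z].

Definition relaxed_cutter (R : realType) (H : completeNormedModType R)
    (dot : {dot H for idfun}) (lambda : R) (T : H -> H) : Prop :=
  [/\ 0 < lambda, Fix T !=set0 &
      forall x z : H, Fix T z ->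
        `|T x - x| ^+ 2 <= lambda * dot (z - x) (T x - x)].

Definition weak_cvg (R : realType) (H : completeNormedModType R)
    (dot : {dot H for idfun}) (x : nat -> H) (l : H) : Prop :=
  forall u : H, (fun k => dot (x k) u) @ \oo --> dot l u.

(* Weak cluster points of sequences are weak limits of subsequences; for
   bounded sequences in a Hilbert space these are exactly the cluster points
   with respect to the weak topology. *)
Definition weak_cluster_point (R : realType) (H : completeNormedModType R)
    (dot : {dot H for idfun}) (x : nat -> H) (l : H) : Prop :=
  exists2 n : nat -> nat, {homo n : i j / (i < j)%N} &
    weak_cvg dot (x \o n) l.

Definition demiclosedness_principle (R : realType)
    (H : completeNormedModType R) (dot : {dot H for idfun})
    (T : H -> H) : Prop :=
  forall x : nat -> H, bounded_fun x ->
    (fun k => `|T (x k) - x k|) @ \oo --> (0 : R) ->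
    forall l : H, weak_cluster_point dot x l -> Fix T l.

(* Main.v *)
Require Import Defs.
From mathcomp Require Import all_boot all_order all_algebra.
From mathcomp Require Import sesquilinear.
From mathcomp Require Import all_classical all_reals all_analysis.
From mathcomp Require Import ring lra.

Import Order.TTheory GRing.Theory Num.Theory.
Import numFieldNormedType.Exports.

Local Open Scope classical_set_scope.
Local Open Scope ring_scope.

(** Write [a := T x - x], [b := U (T x) - T x] and
    [G := |a|^2 / lambda + |b|^2 / mu + <a, b>].

    The two cutter inequalities, taken at [x] for [T] and at [T x] for [U], add
    up to [G <= <z - x, a + b>] for every common fixed point [z]
    ([cutter_gap_le_dot]): the direction [a + b = U (T x) - x] points towards
    the common fixed points by at least [G].  As [lambda * mu < 4], completing
    the square shows that [G] dominates multiples of [|a|^2] and of [|b|^2]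
    ([sqr_norm_le_cutter_gap]), so [G] is positive away from the common fixed
    points.  There the lower bound on [tau x] says [|a + b|^2 <= tau x * G], and
    then a step of length [lam k / tau (x k)] with relaxation [lam k] in
    [[eps, 2 - eps]] satisfies [|x k.+1 - z|^2 <= |x k - z|^2 - c * G k], where
    [c > 0] because [tau] is also bounded above ([relaxed_step_gain]).  So the
    distances to the common fixed points converge and [G k], hence [|a k|] and
    [|b k|], tend to 0.  Demiclosedness of [T] along [x] and of [U] along
    [T \o x], two sequences with the same weak cluster points, puts every weak
    cluster point of [x] into [Fix T `&` Fix U].

    The conclusion is then Opial's argument ([opial]), which rests on weak
    sequential compactness of bounded sequences.  Here an ultrafilter [W] on
    the indices replaces the usual diagonal extraction: every scalar sequence
    [<x k, u>] has a limit along [W], and the Riesz representation theorem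
    turns this linear functional of [u] into a weak limit
    ([ultra_weak_limit]).  A subsequence that converges weakly to the same
    point is chosen greedily, with terms that become orthogonal to all earlier
    ones ([ultra_weak_limit_cluster]). *)

(** * Inner products and the Riesz representation *)

(** The discriminant inequality; it serves both Cauchy-Schwarz and the
    estimate for approximate minimisers in the Riesz representation. *)
Lemma sqr_le_of_quadratic_ge0 (R : realFieldType) (a b c : R) : 0 <= c ->
  (forall t, 0 <= a + 2 * t * b + t ^+ 2 * c) -> b ^+ 2 <= a * c.
Proof.
move=> c_ge0 q_ge0; have [c_eq0|c_neq0] := eqVneq c 0.
  have [->|b_neq0] := eqVneq b 0; first by rewrite c_eq0 mulr0 expr0n.
  (* The quadratic is affine in [t], and takes the value -1 at this point. *)
  have := q_ge0 (- (a + 1) / (2 * b)).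
  suff -> : a + 2 * (- (a + 1) / (2 * b)) * b + (- (a + 1) / (2 * b)) ^+ 2 * c
            = -1 by rewrite oppr_ge0 ler10.
  by rewrite c_eq0; field.
have c_gt0 : 0 < c by rewrite lt_neqAle eq_sym c_neq0.
have := q_ge0 (- b / c).
have -> : a + 2 * (- b / c) * b + (- b / c) ^+ 2 * c = (a * c - b ^+ 2) / c.
  by field.
by rewrite pmulr_lge0 ?invr_gt0 // subr_ge0.
Qed.

Section InnerProduct.
Context {R : realType} {H : completeNormedModType R}.
Variable dot : {dot H for idfun}.
Hypothesis norm_dot : hilbert_norm dot.

Lemma dotC (u v : H) : dot u v = dot v u.
Proof. by rewrite [LHS]hermC expr0 mul1r. Qed.

(** The bilinearity laws, stated for [dot] itself so that [ring] and [lra] see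
    the values of [dot] as the same atoms throughout. *)
Lemma dot0r (u : H) : dot u 0 = 0.
Proof. exact: linear0r. Qed.

Lemma dotDl (u v w : H) : dot (u + v) w = dot u w + dot v w.
Proof. exact: linearDl. Qed.

Lemma dotDr (u v w : H) : dot u (v + w) = dot u v + dot u w.
Proof. exact: linearDr. Qed.

Lemma dotBl (u v w : H) : dot (u - v) w = dot u w - dot v w.
Proof. exact: linearBl. Qed.

Lemma dotNr (u v : H) : dot u (- v) = - dot u v.
Proof. exact: linearNr. Qed.

Lemma dotZr (a : R) (u v : H) : dot u (a *: v) = a * dot u v.
Proof. by rewrite linearZr_LR. Qed.

Lemma sqr_normD (u v : H) :
  `|u + v| ^+ 2 = `|u| ^+ 2 + 2 * dot u v + `|v| ^+ 2.
Proof. by rewrite !norm_dot dotDl !dotDr (dotC v u); ring. Qed.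

Lemma sqr_normB (u v : H) :
  `|u - v| ^+ 2 = `|u| ^+ 2 - 2 * dot u v + `|v| ^+ 2.
Proof. by rewrite sqr_normD dotNr normrN; ring. Qed.

Lemma cauchy_schwarz (u v : H) : `|dot u v| <= `|u| * `|v|.
Proof.
rewrite -ler_sqr ?nnegrE ?mulr_ge0 // -normrX ger0_norm ?sqr_ge0 // exprMn.
apply: sqr_le_of_quadratic_ge0 => [|t]; first exact: sqr_ge0.
have : 0 <= `|u + t *: v| ^+ 2 by exact: sqr_ge0.
by rewrite sqr_normD dotZr normrZ exprMn real_normK ?num_real // mulrA.
Qed.

Lemma dot_cvg {T : Type} (F : set_system T) {FF : Filter F} (f : T -> H)
    (l u : H) : f @ F --> l -> (fun k => dot (f k) u) @ F --> dot l u.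
Proof.
move=> fl; have dl0 : (fun k => `|l - f k| * `|u|) @ F --> (0 : R).
  rewrite -(mul0r `|u|); apply: cvgMl; rewrite -(@normr0 _ H) -(subrr l).
  by apply: cvg_norm; apply: cvgB => //; exact: cvg_cst.
apply/cvgrPdist_le => e e0.
move/cvgr0Pnorm_le: dl0 => /(_ e e0); apply: filterS => k.
rewrite -dotBl; apply: le_trans.
by rewrite [leRHS]ger0_norm ?mulr_ge0 // cauchy_schwarz.
Qed.

(** The representing vector minimises [J v = |v|^2 - 2 * phi v] on [M].  If
    [J y] is within [d^2] of the infimum, then [t |-> J (y + t *: v)] being
    bounded below forces [|<y, v> - phi v| <= d * |v|].  Applied to two
    approximate minimisers and [v] their difference, this estimate shows that a
    minimising sequence is Cauchy; applied to a fixed [v], it identifies the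
    functional that the limit represents.  With [phi = <u, _>] the lemma gives
    the orthogonal projection of [u] onto [M]. *)
Lemma riesz_on_subspace (M : set H) (phi : H -> R) (C : R) :
  M 0 -> (forall (a : R) u v, M u -> M v -> M (a *: u + v)) -> closed M ->
  (forall (a : R) u v, M u -> M v -> phi (a *: u + v) = a * phi u + phi v) ->
  (forall v, M v -> phi v <= C * `|v|) ->
  exists2 p, M p & forall v, M v -> phi v = dot p v.
Proof.
move=> M0 Mlin Mclosed phi_lin phi_le.
pose J v := `|v| ^+ 2 - 2 * phi v.
have J_inf : has_inf (J @` M).
  split; first by exists (J 0), 0.
  exists (- C ^+ 2) => _ [v Mv <-]; rewrite /J.
  have := phi_le v Mv; have := sqr_ge0 (`|v| - C); rewrite sqrrB; nra.
have near_min (y v : H) (d : R) : M y -> M v ->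
    J y <= inf (J @` M) + d ^+ 2 -> 0 <= d -> `|dot y v - phi v| <= d * `|v|.
  move=> My Mv Jy d0.
  rewrite -ler_sqr ?nnegrE ?mulr_ge0 // -normrX ger0_norm ?sqr_ge0 // exprMn.
  apply: sqr_le_of_quadratic_ge0 => [|t]; first exact: sqr_ge0.
  have : inf (J @` M) <= J (t *: v + y).
    by apply: ge_inf; [exact: J_inf.2 | exists (t *: v + y) => //; exact: Mlin].
  move: Jy; rewrite /J phi_lin // (addrC (t *: v)) sqr_normD dotZr normrZ.
  by rewrite exprMn real_normK ?num_real //; lra.
have /choice [y yP] (n : nat) :
    exists y, M y /\ J y <= inf (J @` M) + (n.+1%:R^-1) ^+ 2.
  have e0 : 0 < (n.+1%:R^-1 : R) ^+ 2 by rewrite exprn_gt0.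
  by have [_ [v Mv <-] /ltW] := inf_adherent e0 J_inf; exists v.
have dist_y n m : `|y n - y m| <= n.+1%:R^-1 + m.+1%:R^-1.
  have [Mn Jn] := yP n; have [Mm Jm] := yP m.
  have Mw : M (y n - y m) by rewrite addrC -scaleN1r; exact: Mlin.
  have [->|w_neq0] := eqVneq (y n - y m) 0; first by rewrite normr0 addr_ge0.
  rewrite -(ler_pM2r (_ : 0 < `|y n - y m|)) ?normr_gt0 // -expr2 norm_dot.
  have := near_min _ _ _ Mn Mw Jn; have := near_min _ _ _ Mm Mw Jm.
  rewrite !invr_ge0 !ler0n => /(_ isT) + /(_ isT).
  (* [phi] cancels between the estimates for [y n] and [y m]. *)
  rewrite dotBl !ler_norml => /andP[+ _] /andP[_ +].
  have aux (p q f d e w : R) :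
      - (e * w) <= q - f -> p - f <= d * w -> p - q <= (d + e) * w by lra.
  exact: aux.
have inv0 : (fun n => n.+1%:R^-1 : R) @ \oo --> 0 by exact: cvg_harmonic.
have /cauchy_exP/cauchy_cvgP y_cvg : cauchy_ex (y @ \oo).
  move=> e e0; have e20 : 0 < e / 2 by rewrite divr_gt0.
  move/cvgr0Pnorm_lt: inv0 => /(_ _ e20) [N _ HN].
  exists (y N); exists N => // n /= Nn; rewrite -ball_normE /=.
  apply: le_lt_trans (dist_y _ _) _; rewrite [e]splitr ltrD //.
    by have := HN N (leqnn N); rewrite /= ger0_norm.
  by have := HN n Nn; rewrite /= ger0_norm.
exists (lim (y @ \oo)) => [|v Mv].
  by apply: (closed_cvg _ Mclosed) y_cvg; apply: nearW => n; exact: (yP n).1.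
have dy_phi : (fun n => dot (y n) v) @ \oo --> phi v.
  have b0 : (fun n => n.+1%:R^-1 * `|v| : R) @ \oo --> 0.
    by rewrite -(mul0r `|v|); exact: cvgMl.
  apply/cvgrPdist_le => e e0; move/cvgr0Pnorm_le: b0 => /(_ e e0).
  apply: filterS => n; rewrite ger0_norm ?mulr_ge0 // distrC; apply: le_trans.
  by have [Mn Jn] := yP n; exact: near_min.
by apply: (@cvg_unique _ (@Rhausdorff R) _ _ _ _ dy_phi); exact: dot_cvg.
Qed.

End InnerProduct.

(** * Limits along ultrafilters *)

Lemma fmap_ultra {T U : Type} (f : T -> U) (F : set_system T) :
  UltraFilter F -> UltraFilter (f @ F).
Proof.
move=> FU; split; first exact: fmap_proper_filter.
move=> G GF sFG; apply/seteqP; split=> // A GA.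
have [//|FnA] := in_ultra_setVsetC (f @^-1` A) FU.
have GnA : G (~` A) by exact: sFG.
by have [x []] := filter_ex (filterI GA GnA).
Qed.

(** If [F] does not contain the preimage of some neighbourhood [B] of [l], then
    [F] together with the complement of that preimage generates a proper filter,
    and an ultrafilter finer than it contradicts the hypothesis. *)
Lemma cvg_of_ultra {T : Type} {U : topologicalType} (F : set_system T)
    {FF : ProperFilter F} (f : T -> U) (l : U) :
  (forall W, UltraFilter W -> F `<=` W -> f @ W --> l) -> f @ F --> l.
Proof.
move=> ultra_cvg B Bl; apply: contrapT => nFB.
have G_proper : ProperFilter (within (~` (f @^-1` B)) F).
  split; last exact: within_filter.
  move=> FB; apply: nFB; apply: (@filterS _ F _ _ _ _ FB) => k. exact: contrapT.
have [W [WU sW]] := ultraFilterLemma G_proper.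
have WnB : W (~` (f @^-1` B)) by apply: sW; apply: (@nearW _ F).
have sFW : F `<=` W by move=> A FA; apply: sW; apply: (filterS _ FA) => k Ak _.
have WB : W (f @^-1` B) by exact: ultra_cvg Bl.
by have [k []] := filter_ex (filterI WB WnB).
Qed.

Lemma bounded_ultra_cvg {R : realType} {T : Type} (W : set_system T)
    (f : T -> R) (C : R) :
  UltraFilter W -> (forall k, `|f k| <= C) -> exists l : R, f @ W --> l.
Proof.
move=> WU fC; have := @segment_compact R (- C) C; rewrite compact_ultra.
move=> /(_ _ (fmap_ultra f _ WU)) []; last by move=> l [_]; exists l.
by apply: nearW => k; rewrite /= in_itv /= -ler_norml.
Qed.

Lemma bounded_funP {R : realType} {H : completeNormedModType R}
    (x : nat -> H) : bounded_fun x <-> exists C, forall k, `|x k| <= C.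
Proof.
have setT_proper : ProperFilter (globally [set: nat]).
  exact: (@globally_properfilter _ _ 0%N).
rewrite /= ex_bound; split=> -[C xC]; exists C => k; first exact: xC.
by move=> _; exact: xC.
Qed.

(** * Weak compactness of bounded sequences *)

Section WeakCluster.
Context {R : realType} {H : completeNormedModType R}.
Variable dot : {dot H for idfun}.
Hypothesis norm_dot : hilbert_norm dot.

(** Each bounded scalar sequence [<x k, u>] converges along [W], and the limits
    depend on [u] linearly and boundedly. *)
Lemma ultra_weak_limit (x : nat -> H) (W : set_system nat) :
  bounded_fun x -> UltraFilter W ->
  exists l, forall u, (fun k => dot (x k) u) @ W --> dot l u.
Proof.
move=> /bounded_funP[C xC] WU.
have dot_le u k : `|dot (x k) u| <= C * `|u|.
  by rewrite (le_trans (cauchy_schwarz dot norm_dot _ _)) // ler_wpM2r.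
have /choice[phi phiP] u : exists r, (fun k => dot (x k) u) @ W --> (r : R).
  exact: bounded_ultra_cvg (dot_le u).
have [//|//|//|a u v _ _|v _|l _ lP] :=
  @riesz_on_subspace _ _ _ norm_dot setT phi C.
- have lim_lin : (fun k => dot (x k) (a *: u + v)) @ W --> a * phi u + phi v.
    under eq_fun do rewrite dotDr dotZr.
    by apply: cvgD => //; apply: cvgMr.
  exact: (@cvg_unique _ (@Rhausdorff R) _ _ _ _ (phiP _) lim_lin).
- apply: (cvgr_to_le (phiP v)).
  by apply: nearW => k; exact: le_trans (ler_norm _) (dot_le v k).
by exists l => u; rewrite -lP //; exact: phiP.
Qed.

(** Put [y k := x k - l], which tends weakly to 0 along [W].  Sets of [W] being
    infinite, indices [n k] can be picked one after the other so that [y (n k)]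
    is nearly orthogonal to all the [y j] with [j] up to the previous index.
    Then [<y (n k), u>] tends to 0 for [u] in the closed subspace [M] where this
    happens, and [M] contains all the [y j].  An arbitrary [u] has the same
    products with the [y (n k)] as its projection onto [M]. *)
Lemma ultra_weak_limit_cluster (x : nat -> H) (W : set_system nat) (l : H) :
  bounded_fun x -> UltraFilter W -> \oo `<=` W ->
  (forall u, (fun k => dot (x k) u) @ W --> dot l u) ->
  weak_cluster_point dot x l.
Proof.
move=> /bounded_funP[C xC] WU ooW xl.
pose y k := x k - l.
have yW u : (fun k => dot (y k) u) @ W --> 0.
  rewrite -(subrr (dot l u)); under eq_fun do rewrite dotBl.
  by apply: cvgB => //; exact: cvg_cst.
have /choice[next nextP] (N : nat) : exists m, (N < m)%N /\
    forall j, (j <= N)%N -> `|dot (y m) (y j)| <= N.+1%:R^-1.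
  have small : \forall m \near W, forall j : 'I_N.+1,
      `|dot (y m) (y j)| <= N.+1%:R^-1.
    apply: filter_forall => j.
    by move/cvgr0Pnorm_le: (yW (y j)); apply; rewrite invr_gt0.
  have [m [smallm Nm]] := filter_ex (filterI small (ooW _ (nbhs_infty_gt N))).
  by exists m; split => // j jN; exact: (smallm (Ordinal (jN : (j < N.+1)%N))).
pose n k := iter k next 0%N.
have n_homo : {homo n : i j / (i < j)%N}.
  by apply: homo_ltn => [i j k|k]; [exact: ltn_trans | exact: (nextP _).1].
have n_ge k : (k <= n k)%N.
  by elim: k => // k /leq_ltn_trans; apply; exact: n_homo.
have inv0 : (fun k => k.+1%:R^-1 : R) @ \oo --> 0 by exact: cvg_harmonic.
have yn_yj j : (fun k => dot (y (n k)) (y j)) @ \oo --> 0.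
  rewrite -cvg_shiftS; apply/cvgr0Pnorm_le => e e0.
  move/cvgr0Pnorm_le: inv0 => /(_ e e0) small.
  near=> k; have jk : (j <= k)%N by near: k; exact: nbhs_infty_ge.
  apply: (le_trans ((nextP (n k)).2 _ (leq_trans jk (n_ge k)))).
  rewrite (@le_trans _ _ k.+1%:R^-1) //.
    by rewrite lef_pV2 ?posrE // ler_nat ltnS.
  have : `|k.+1%:R^-1 : R| <= e by near: k.
  by rewrite ger0_norm.
pose M := [set u | (fun k => dot (y (n k)) u) @ \oo --> 0].
have Mlin (a : R) u v : M u -> M v -> M (a *: u + v).
  rewrite /M /= => Mu Mv; under eq_fun do rewrite dotDr dotZr.
  by rewrite -(addr0 0) -{1}(mulr0 a); apply: cvgD => //; exact: cvgMr.
have M0 : M 0.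
  rewrite /M /=; under eq_fun do rewrite dot0r.
  exact: cvg_cst.
pose D := C + `|l|.
have yD k : `|y k| <= D by rewrite (le_trans (ler_normB _ _)) // lerD2r.
have Mclosed : closed M.
  move=> u Mu; apply/cvgr0Pnorm_le => e e0.
  have D1 : 0 < `|D| + 1 by rewrite ltr_wpDl.
  have d0 : 0 < e / 2 / (`|D| + 1) by rewrite !divr_gt0.
  have [v [Mv uv]] := Mu _ (nbhsx_ballx u _ d0).
  have e20 : 0 < e / 2 by rewrite divr_gt0.
  move/cvgr0Pnorm_le: Mv => /(_ _ e20); apply: filterS => k dv.
  have -> : dot (y (n k)) u = dot (y (n k)) (u - v) + dot (y (n k)) v.
    by rewrite -dotDr subrK.
  rewrite (le_trans (ler_normD _ _)) // [leRHS]splitr lerD //.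
  rewrite (le_trans (cauchy_schwarz dot norm_dot _ _)) //.
  move: uv; rewrite -ball_normE /= => /ltW uv.
  have yD1 : `|y (n k)| <= `|D| + 1.
    by rewrite (le_trans (yD _)) // (le_trans (ler_norm D)) // lerDl.
  apply: (le_trans (ler_pM _ _ yD1 uv)) => //.
  by rewrite mulrC divfK // gt_eqF.
exists n => // u.
(* [p] is the orthogonal projection of [u] onto [M]. *)
have [p Mp pP] : exists2 p, M p & forall v, M v -> dot u v = dot p v.
  apply: (@riesz_on_subspace _ _ _ norm_dot M (dot u) `|u|) => //.
    by move=> a v w _ _; rewrite dotDr dotZr.
  by move=> v _; exact: le_trans (ler_norm _) (cauchy_schwarz dot norm_dot _ _).
have xE k : dot (x (n k)) u = dot (y (n k)) p + dot l u.
  have -> : dot (y (n k)) p = dot (y (n k)) u.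
    by rewrite dotC -pP 1?dotC //; exact: yn_yj.
  by rewrite -dotDl subrK.
rewrite /comp; under eq_fun do rewrite xE.
suff : (fun k => dot (y (n k)) p + dot l u) @ \oo --> 0 + dot l u.
  by rewrite add0r.
by apply: cvgD => //; exact: cvg_cst.
Unshelve. all: by end_near. Qed.

End WeakCluster.

(** * Weak convergence of Fejer monotone sequences *)

Lemma cvgn0_of_sqr_le {R : realType} (u D : nat -> R) (K : R) :
  (forall k, 0 <= u k) -> (forall k, u k ^+ 2 <= K * D k) ->
  D @ \oo --> 0 -> u @ \oo --> 0.
Proof.
move=> u_ge0 uD D0.
have KD0 : (fun k => K * D k) @ \oo --> 0 by rewrite -(mulr0 K); exact: cvgMr.
apply/cvgr0Pnorm_le => e e0.
have e20 : 0 < e ^+ 2 by rewrite exprn_gt0.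
move/cvgr0Pnorm_le: KD0 => /(_ _ e20); apply: filterS => k.
move=> KDk; rewrite (ger0_norm (u_ge0 k)) -ler_sqr ?nnegrE ?(ltW e0) //.
exact: le_trans (uD k) (le_trans (ler_norm _) KDk).
Qed.

(** A nonnegative quantity [V] that loses at least [c * D k] at step [k]
    converges, so its increments, and with them [D], tend to 0. *)
Lemma dissipation_cvg {R : realType} (V D : nat -> R) (c : R) :
  0 < c -> (forall k, 0 <= V k) -> (forall k, 0 <= D k) ->
  (forall k, c * D k <= V k - V k.+1) -> cvgn V /\ D @ \oo --> 0.
Proof.
move=> c0 V0 D0 VD.
have V_cvg : cvgn V.
  apply: nonincreasing_is_cvgn; last first.
    by exists 0 => _ [k _ <-]; exact: V0.
  apply/nonincreasing_seqP => k; rewrite -subr_ge0.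
  by apply: le_trans (VD k); rewrite mulr_ge0 ?(ltW c0).
split=> //.
have bound0 : (fun k => c^-1 * (V k - V k.+1)) @ \oo --> 0.
  rewrite -(mulr0 c^-1) -(subrr (limn V)); apply: cvgMr.
  by apply: cvgB => //; rewrite (cvg_shiftS V).
apply: (@squeeze_cvgr _ _ _ _ (fun=> 0)); [|exact: cvg_cst|exact: bound0].
by apply: nearW => k; rewrite D0 /= mulrC ler_pdivlMr // mulrC.
Qed.

Section Opial.
Context {R : realType} {H : completeNormedModType R}.
Variable dot : {dot H for idfun}.
Hypothesis norm_dot : hilbert_norm dot.

Lemma weak_cluster_point_perturb (x y : nat -> H) (l : H) :
  (fun k => `|y k - x k|) @ \oo --> (0 : R) ->
  weak_cluster_point dot x l -> weak_cluster_point dot y l.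
Proof.
move=> yx0 [n n_homo xl]; exists n => // u.
have n_infty : n @ \oo --> \oo.
  apply/cvgnyPge => A; exists A => // k /= Ak; apply: (leq_trans Ak).
  by elim: k {Ak} => // k /leq_ltn_trans; apply; exact: n_homo.
have diff0 : (fun k => y k - x k) @ \oo --> (0 : H) by exact/norm_cvg0P.
have du0 : (fun k => dot (y (n k) - x (n k)) u) @ \oo --> dot 0 u.
  exact: (dot_cvg dot norm_dot \oo _ _ u (cvg_comp n _ n_infty diff0)).
have -> : (fun k => dot ((y \o n) k) u) =
    (fun k => dot (y (n k) - x (n k)) u + dot ((x \o n) k) u).
  by apply/funext => k; rewrite -dotDl subrK.
suff : (fun k => dot (y (n k) - x (n k)) u + dot ((x \o n) k) u) @ \oo
    --> dot 0 u + dot l u by rewrite -dotDl add0r.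
by apply: cvgD => //; exact: xl.
Qed.

(** Two weak limits [l], [l'] of [x] along ultrafilters are weak cluster points,
    so they lie in [F].  Up to a constant [<x k, l - l'>] is half of the
    difference of [|x k - l'|^2] and [|x k - l|^2], hence it converges; its
    limits along the two ultrafilters, [<l, l - l'>] and [<l', l - l'>], agree,
    and [l = l'].  A sequence with a single limit along all ultrafilters
    converges to it. *)
Lemma opial (x : nat -> H) (F : set H) : bounded_fun x ->
  (forall z, F z -> cvgn (fun k => `|x k - z| ^+ 2)) ->
  (forall l, weak_cluster_point dot x l -> F l) ->
  exists2 l, F l & weak_cvg dot x l.
Proof.
move=> xB x_dist x_cluster.
have ultraF (W : set_system nat) : UltraFilter W -> \oo `<=` W ->
    exists2 l, F l & forall u, (fun k => dot (x k) u) @ W --> dot l u.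
  move=> WU ooW; have [l xl] := ultra_weak_limit dot norm_dot x W xB WU.
  by exists l => //; apply: x_cluster; exact: ultra_weak_limit_cluster xl.
have ultra_uniq W W' l l' : UltraFilter W -> UltraFilter W' ->
    \oo `<=` W -> \oo `<=` W' -> F l -> F l' ->
    (forall u, (fun k => dot (x k) u) @ W --> dot l u) ->
    (forall u, (fun k => dot (x k) u) @ W' --> dot l' u) -> l = l'.
  move=> WU W'U ooW ooW' Fl Fl' xl xl'.
  have dotE k : dot (x k) (l - l') = 2^-1 *
      ((`|x k - l'| ^+ 2 - `|x k - l| ^+ 2) + (`|l| ^+ 2 - `|l'| ^+ 2)).
    by rewrite !(sqr_normB dot norm_dot) dotDr dotNr; field.
  have [c xc] : exists c : R, (fun k => dot (x k) (l - l')) @ \oo --> c.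
    have := x_dist _ Fl; have := x_dist _ Fl' => /cvg_ex[r' xr'] /cvg_ex[r xr].
    exists (2^-1 * ((r' - r) + (`|l| ^+ 2 - `|l'| ^+ 2))).
    under eq_fun do rewrite dotE.
    by apply: cvgMr; apply: cvgD; [exact: cvgB | exact: cvg_cst].
  have lim_c W0 l0 : UltraFilter W0 -> \oo `<=` W0 ->
      (forall u, (fun k => dot (x k) u) @ W0 --> dot l0 u) ->
      dot l0 (l - l') = c.
    move=> W0U ooW0 xl0.
    apply: (@cvg_unique _ (@Rhausdorff R) _ _ _ _ (xl0 _)).
    by move=> B /xc /ooW0.
  have : `|l - l'| ^+ 2 = 0.
    by rewrite norm_dot dotBl (lim_c W) // (lim_c W') // subrr.
  by move/eqP; rewrite sqrf_eq0 normr_eq0 subr_eq0 => /eqP.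
have [W0 [W0U ooW0]] := ultraFilterLemma eventually_filter.
have [l Fl xl] := ultraF W0 W0U ooW0.
exists l => // u; apply: cvg_of_ultra => W WU ooW.
have [l' Fl' xl'] := ultraF W WU ooW.
by rewrite (ultra_uniq W0 W l l').
Qed.

End Opial.

(** * The composition of two relaxed cutters *)

Section RelaxedCutters.
Context {R : realType} {H : completeNormedModType R}.
Variable dot : {dot H for idfun}.
Hypothesis norm_dot : hilbert_norm dot.
Variables lambda mu : R.
Hypotheses (lambda_gt0 : 0 < lambda) (mu_gt0 : 0 < mu).

(** The denominator in the lower bound for [tau]. *)
Definition cutter_gap (a b : H) : R :=
  lambda^-1 * `|a| ^+ 2 + mu^-1 * `|b| ^+ 2 + dot a b.

(** The cutter inequality of [U] at [T x] involves [z - T x = (z - x) - a]; the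
    cross term of the gap compensates for this shift of the base point. *)
Lemma cutter_gap_le_dot (T U : H -> H) (x z : H) :
  relaxed_cutter dot lambda T -> relaxed_cutter dot mu U ->
  Fix T z -> Fix U z ->
  cutter_gap (T x - x) (U (T x) - T x) <=
    dot (z - x) ((T x - x) + (U (T x) - T x)).
Proof.
move=> [_ _ cutT] [_ _ cutU] Tz Uz; rewrite /cutter_gap.
have hT := cutT x z Tz; have := cutU (T x) z Uz.
have -> : z - T x = (z - x) - (T x - x) by rewrite opprB addrA subrK.
rewrite dotBl (dotDr dot (z - x) (T x - x)) => hU.
have {}hT : lambda^-1 * `|T x - x| ^+ 2 <= dot (z - x) (T x - x).
  by rewrite mulrC ler_pdivrMr // mulrC.
move: hU; rewrite -ler_pdivrMl // => hU.
by rewrite -addrA lerD // -lerBrDr.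
Qed.

(** Completing the square, the gap is
    [(4 - lambda * mu) / (4 * lambda) * |a|^2 + |b + (mu / 2) *: a|^2 / mu],
    and likewise with the roles of [a] and [b] exchanged. *)
Lemma sqr_norm_le_cutter_gap (a b : H) : lambda * mu < 4 ->
  `|a| ^+ 2 <= 4 * lambda / (4 - lambda * mu) * cutter_gap a b /\
  `|b| ^+ 2 <= 4 * mu / (4 - lambda * mu) * cutter_gap a b.
Proof.
move=> lm; have lm0 : 0 < 4 - lambda * mu by rewrite subr_gt0.
have l0 : lambda != 0 by rewrite gt_eqF.
have m0 : mu != 0 by rewrite gt_eqF.
have d0 : 4 - lambda * mu != 0 by rewrite gt_eqF.
split; rewrite -subr_ge0.
  have -> : 4 * lambda / (4 - lambda * mu) * cutter_gap a b - `|a| ^+ 2 =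
      4 * lambda / (4 - lambda * mu) / mu * `|b + (mu / 2) *: a| ^+ 2.
    rewrite /cutter_gap (sqr_normD dot norm_dot) dotZr normrZ (dotC _ b a).
    by rewrite exprMn real_normK ?num_real //; field; rewrite l0 m0 d0.
  by rewrite !mulr_ge0 ?invr_ge0 // ltW.
have -> : 4 * mu / (4 - lambda * mu) * cutter_gap a b - `|b| ^+ 2 =
    4 * mu / (4 - lambda * mu) / lambda * `|a + (lambda / 2) *: b| ^+ 2.
  rewrite /cutter_gap (sqr_normD dot norm_dot) dotZr normrZ exprMn.
  by rewrite real_normK ?num_real //; field; rewrite l0 m0 d0.
by rewrite !mulr_ge0 ?invr_ge0 // ltW.
Qed.

Lemma Fix_of_cutter_gap_le0 (T U : H -> H) (x : H) : lambda * mu < 4 ->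
  cutter_gap (T x - x) (U (T x) - T x) <= 0 -> (Fix T `&` Fix U) x.
Proof.
move=> lm G0; have lm0 : 0 < 4 - lambda * mu by rewrite subr_gt0.
have [ha hb] := sqr_norm_le_cutter_gap (T x - x) (U (T x) - T x) lm.
have eq0 (v : H) (r : R) : 0 < r ->
    `|v| ^+ 2 <= r / (4 - lambda * mu) *
      cutter_gap (T x - x) (U (T x) - T x) -> v = 0.
  move=> r0 hv; apply/eqP; rewrite -normr_eq0 -sqrf_eq0 eq_le sqr_ge0 andbT.
  by apply: (le_trans hv); rewrite mulr_ge0_le0 // divr_ge0 // ltW.
have Tx : T x = x.
  by apply/subr0_eq/(eq0 _ (4 * lambda)); rewrite ?mulr_gt0.
split=> //; rewrite /Fix /= -{1}Tx -[RHS]Tx.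
by apply/subr0_eq/(eq0 _ (4 * mu)); rewrite ?mulr_gt0.
Qed.

End RelaxedCutters.

(** The gain of one step of length [t := l / tau] in the squared distance, with
    [G] the gap, [P = <z - x, a + b>] and [S = |a + b|^2].  It is at least
    [t * (2 - l) * G], where [t >= eps / N] and [2 - l >= eps]. *)
Lemma relaxed_step_gain (R : realFieldType) (eps l tau N G P S : R) :
  0 < eps -> eps <= l <= 2 - eps -> 0 < tau <= N -> 0 <= G -> G <= P ->
  S <= tau * G ->
  eps ^+ 2 / N * G <= 2 * (l / tau) * P - (l / tau) ^+ 2 * S.
Proof.
move=> e0 /andP[le_el le_l] /andP[tau0 tauN] G0 GP SG.
set t := l / tau.
have l0 : 0 < l by exact: lt_le_trans le_el.
have t0 : 0 <= t by rewrite divr_ge0 // ltW.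
have tE : t * tau = l by rewrite divfK // gt_eqF.
have N0 : 0 < N by exact: lt_le_trans tauN.
have t_ge : eps / N <= t.
  by apply: ler_pM; rewrite ?invr_ge0 ?(ltW e0) ?(ltW N0) ?lef_pV2.
have e_le : eps / N * eps <= t * (2 - l).
  by apply: ler_pM => //; rewrite ?divr_ge0 ?(ltW e0) ?(ltW N0) //; lra.
have lhs_le : eps ^+ 2 / N * G <= t * (2 - l) * G.
  by rewrite ler_wpM2r // expr2 mulrAC.
apply: le_trans lhs_le _.
have -> : t * (2 - l) * G = 2 * t * G - t ^+ 2 * (tau * G).
  by rewrite -tE; ring.
apply: lerB; last by rewrite ler_wpM2l ?sqr_ge0.
by rewrite ler_wpM2l ?(mulr_ge0 (ler0n _ 2) t0).
Qed.

Theorem theorem4p5 (R : realType) (H : completeNormedModType R)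
    (dot : {dot H for idfun}) (norm_dot : hilbert_norm dot)
    (H_neq0 : exists v : H, v != 0)
    (lambda mu : R) (lambda_gt0 : 0 < lambda) (mu_gt0 : 0 < mu)
    (T U : H -> H)
    (cutT : relaxed_cutter dot lambda T) (cutU : relaxed_cutter dot mu U)
    (FixTU : Fix T `&` Fix U !=set0)
    (demiT : demiclosedness_principle dot T)
    (demiU : demiclosedness_principle dot U)
    (lambda_mu : lambda * mu < 4)
    (tau : H -> R) (tau_gt0 : forall x : H, 0 < tau x)
    (tau_bounds : forall x : H, ~ (Fix T `&` Fix U) x ->
       let a1 := T x - x in
       let b1 := (U \o T) x - T x in
       let nu_star := 4 * (lambda + mu - lambda * mu) / (4 - lambda * mu) in
       `|a1 + b1| ^+ 2 /
         (lambda^-1 * `|a1| ^+ 2 + mu^-1 * `|b1| ^+ 2 + dot a1 b1)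
         <= tau x <= nu_star)
    (eps : R) (eps_gt0 : 0 < eps) (eps_lt1 : eps < 1)
    (lam : nat -> R) (lam_bounds : forall k : nat, eps <= lam k <= 2 - eps)
    (x : nat -> H)
    (x_rec : forall k : nat,
       x k.+1 = x k + (lam k / tau (x k)) *: ((U \o T) (x k) - x k)) :
  exists2 z : H, (Fix T `&` Fix U) z & weak_cvg dot x z.
Proof.
pose nu := 4 * (lambda + mu - lambda * mu) / (4 - lambda * mu).
(* An upper bound for [tau] outside the common fixed points that is positive
   whatever the sign of [nu]. *)
pose N := `|nu| + 1.
have N_gt0 : 0 < N by rewrite ltr_wpDl.
have c_gt0 : 0 < eps ^+ 2 / N by rewrite divr_gt0 ?exprn_gt0.
pose a k := T (x k) - x k; pose b k := U (T (x k)) - T (x k).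
pose G k := cutter_gap dot lambda mu (a k) (b k).
have sqr_le k := sqr_norm_le_cutter_gap dot norm_dot lambda mu
  lambda_gt0 mu_gt0 (a k) (b k) lambda_mu.
have Fix_of_G k : G k <= 0 -> (Fix T `&` Fix U) (x k).
  by apply: Fix_of_cutter_gap_le0.
have at_Fix k : (Fix T `&` Fix U) (x k) -> a k + b k = 0 /\ G k = 0.
  move=> [Tx Ux]; have [a0 b0] : a k = 0 /\ b k = 0.
    by rewrite /a /b Tx Ux subrr.
  rewrite /G /cutter_gap a0 b0 addr0 normr0 expr0n dot0r /= !mulr0 !addr0.
  by split.
have G_ge0 k : 0 <= G k.
  rewrite leNgt; apply/negP => G_lt0.
  by have [_ G0] := at_Fix k (Fix_of_G k (ltW G_lt0)); rewrite G0 ltxx in G_lt0.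
have fejer z k : (Fix T `&` Fix U) z ->
    eps ^+ 2 / N * G k <= `|x k - z| ^+ 2 - `|x k.+1 - z| ^+ 2.
  move=> [Tz Uz].
  have abE : U (T (x k)) - x k = a k + b k by rewrite /a /b [RHS]addrC subrKA.
  have GP : G k <= dot (z - x k) (a k + b k) by exact: cutter_gap_le_dot.
  have -> : `|x k - z| ^+ 2 - `|x k.+1 - z| ^+ 2 =
      2 * (lam k / tau (x k)) * dot (z - x k) (a k + b k) -
      (lam k / tau (x k)) ^+ 2 * `|a k + b k| ^+ 2.
    rewrite x_rec /= abE addrAC (sqr_normD dot norm_dot (x k - z)) dotZr.
    rewrite normrZ exprMn real_normK ?num_real // -(opprB (x k) z).
    by rewrite (dotC _ (- _)) dotNr (dotC _ (a k + b k)); ring.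
  have [Gk0|Gk0] := leP (G k) 0.
    (* At a common fixed point the iteration stops. *)
    have [ab0 ->] := at_Fix k (Fix_of_G k Gk0).
    by rewrite ab0 normr0 dot0r expr0n /= !mulr0 subrr.
  have xk_notFix : ~ (Fix T `&` Fix U) (x k).
    by move=> /at_Fix[_ G0]; rewrite G0 ltxx in Gk0.
  have /andP[tau_ge tau_le] := tau_bounds _ xk_notFix.
  apply: (relaxed_step_gain _ _ _ _ _ _ _ _ eps_gt0 (lam_bounds k)) => //.
    rewrite tau_gt0 (le_trans tau_le) // (le_trans (ler_norm _)) //.
    by rewrite lerDl.
  by rewrite -ler_pdivrMr.
have [z0 z0F] := FixTU.
have dissipation z : (Fix T `&` Fix U) z ->
    cvgn (fun k => `|x k - z| ^+ 2) /\ G @ \oo --> 0.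
  move=> zF; apply: dissipation_cvg c_gt0 _ G_ge0 _ => k; first exact: sqr_ge0.
  exact: fejer.
have G_cvg0 := (dissipation _ z0F).2.
have a_cvg0 : (fun k => `|a k|) @ \oo --> (0 : R).
  by apply: (cvgn0_of_sqr_le _ G) G_cvg0 => // k; exact: (sqr_le k).1.
have b_cvg0 : (fun k => `|b k|) @ \oo --> (0 : R).
  by apply: (cvgn0_of_sqr_le _ G) G_cvg0 => // k; exact: (sqr_le k).2.
have x_bounded : bounded_fun x.
  apply/bounded_funP; exists (`|x 0%N - z0| + `|z0|) => k.
  rewrite -[x k](subrK z0) (le_trans (ler_normD _ _)) // lerD2r.
  elim: k => // k; apply: le_trans; rewrite -ler_sqr ?nnegrE // -subr_ge0.
  by apply: le_trans (fejer z0 k z0F); rewrite mulr_ge0 // ltW.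
have Tx_bounded : bounded_fun (T \o x).
  have /bounded_funP[C xC] := x_bounded.
  have /bounded_fun_has_ubound[A aA] := cvg_seq_bounded (cvgP _ a_cvg0).
  apply/bounded_funP; exists (A + C) => k.
  rewrite /= -(subrK (x k) (T (x k))) (le_trans (ler_normD _ _)) // lerD //.
  by apply: aA; exists k.
apply: (opial dot norm_dot) => // [z /dissipation[]//|l xl]; split.
  exact: (demiT _ x_bounded a_cvg0).
apply: (demiU _ Tx_bounded b_cvg0).
exact: weak_cluster_point_perturb xl.
Qed.
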